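(* For a Tychonoff space $X$, the following assertions are equivalent: (i) $X$ is discrete; (ii) the free locally convex space $L(X)$ is barrelled; (iii) $L(X)$ is quasibarrelled.
   Context: All vector spaces are over $\mathbb{R}$; all topological spaces are Tychonoff (so locally convex spaces are Hausdorff). The free locally convex space over a Tychonoff space $X$ is a locally convex space $L(X)$ together with a continuous map $i:X\to L(X)$ such that for every continuous map $f$ from $X$ to a locally convex space $E$ there is a unique continuous linear operator $\bar f:L(X)\to E$ with $f=\bar f\circ i$. A barrel is a closed, absolutely convex, absorbing subset. A locally convex space is barrelled if every barrel is a neighborhood of zero, and quasibarrelled if every bornivorous barrel (a barrel absorbing every bounded set) is a neighborhood of zero. *)

(* Defs.v *)
From HB Require Import structures.
From mathcomp Require Import all_boot all_order all_algebra.
From mathcomp Require Import all_classical all_reals all_analysis.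
Import numFieldNormedType.Exports.

Set Implicit Arguments.
Unset Strict Implicit.
Unset Printing Implicit Defensive.

Import Order.TTheory GRing.Theory Num.Theory.

Local Open Scope classical_set_scope.
Local Open Scope ring_scope.

Definition discrete_space (X : topologicalType) : Prop :=
  forall A : set X, open A.

(* The library phrases complete regularity with uniform separators; the usual
   separation by a continuous real function is lemma [uniform_separatorP]. *)
Definition tychonoff_space (X : topologicalType) : Prop :=
  hausdorff_space X /\ completely_regular_space X.

(* A subset A absorbs B when B is contained in t *: A for all large `|t|. *)
Definition absorbs (R : realType) (E : lmodType R) (A B : set E) : Prop :=
  exists2 r : R, 0 < r & forall t : R, r <= `|t| -> B `<=` *:%R t @` A.

Definition absorbing (R : realType) (E : lmodType R) (A : set E) : Prop :=
  forall x : E, absorbs A [set x].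

Definition balanced (R : realType) (E : lmodType R) (A : set E) : Prop :=
  forall (t : R) (x : E), `|t| <= 1 -> A x -> A (t *: x).

Definition absolutely_convex (R : realType) (E : lmodType R) (A : set E) :
    Prop :=
  convex_set A /\ balanced A.

(* Boundedness in the sense of von Neumann; the library's [bounded_set] needs
   a norm. *)
Definition tvs_bounded (R : realType) (E : tvsType R) (B : set E) : Prop :=
  forall U : set E, nbhs (0 : E) U -> absorbs U B.

Definition barrel (R : realType) (E : tvsType R) (A : set E) : Prop :=
  [/\ closed A, absolutely_convex A & absorbing A].

Definition bornivorous (R : realType) (E : tvsType R) (A : set E) : Prop :=
  forall B : set E, tvs_bounded B -> absorbs A B.

Definition barrelled (R : realType) (E : tvsType R) : Prop :=
  forall A : set E, barrel A -> nbhs (0 : E) A.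

Definition quasibarrelled (R : realType) (E : tvsType R) : Prop :=
  forall A : set E, barrel A -> bornivorous A -> nbhs (0 : E) A.

(* Local convexity is part of [tvsType], separation is not. Only the topology
   of E is involved, not the uniformity that [tvsType] also carries. *)
Definition free_lcs (R : realType) (X : topologicalType) (L : tvsType R)
    (i : X -> L) : Prop :=
  [/\ hausdorff_space L,
      continuous i
    & forall (E : tvsType R) (f : X -> E),
        hausdorff_space E -> continuous f ->
        exists! g : L -> E, [/\ linear g, continuous g & f = g \o i] ].

(* Main.v *)
Require Import Defs.
From HB Require Import structures.
From mathcomp Require Import all_boot all_order all_algebra.
From mathcomp Require Import all_classical all_reals all_analysis.
From mathcomp Require Import lra ring.

(** The free locally convex space L over X carries the finest locally convex
    topology that makes i continuous.  Lemma [free_lcs_nbhs0] puts this in a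
    usable form: an absolutely convex set A that absorbs every point i x, and
    whose gauge p_A satisfies p_A (i y - i x) --> 0 as y --> x for each x, is a
    neighborhood of 0.  The reason is that the span S of A, with the topology
    of L refined by p_A, is a Hausdorff locally convex space in which i is
    still continuous.  The universal property of L gives a continuous linear
    map L -> S, and its uniqueness, applied to the target L, shows that this
    map followed by the inclusion is the identity.  So S is all of L, and p_A
    is continuous on L.

    If X is discrete, the continuity of the gauge along i is vacuous, so every
    barrel is a neighborhood of 0.

    Conversely, a continuous linear functional on L is determined by its values
    on X, and every continuous function on X arises in this way.  Let A be the
    polar in L of the functionals bounded by 1 on X, that is, the unit ball for
    the total variation of the elements of L seen as finitely supported
    measures.  It is a barrel.  It is also bornivorous
    ([sup_dual_ball_unif_bounded]): otherwise a bounded set B contains points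
    v_n, and there are functionals g_n bounded by 1 on X, with
    |g_n v_n| > 4 ^ n.  The set of all v such that |g_n v| <= 2 ^ n for each n
    is a neighborhood of 0 by [free_lcs_nbhs0], because only finitely many of
    these constraints restrict i y - i x, on which g_n is at most 2.  Hence it
    absorbs B, which contradicts the growth of g_n v_n.

    If L is quasibarrelled, A is therefore a neighborhood of 0, and so
    2 (i y - i x) lies in A for y near x.  If y were different from x, a
    continuous function from X to [0, 1] with values 0 at x and 1 at y would
    extend to a functional that takes the value 2 there.  So y = x, and x is
    isolated. *)

Import Order.TTheory GRing.Theory Num.Theory.
Import numFieldNormedType.Exports.

Set Implicit Arguments.
Unset Strict Implicit.
Unset Printing Implicit Defensive.

Local Open Scope classical_set_scope.
Local Open Scope ring_scope.

(** * Gauges of absolutely convex sets *)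

(** Two arbitrary nonnegative weights of sum 1 spare the coercions between
    scalars and elements of the unit interval. *)
Lemma convex_setP (R : realType) (E : lmodType R) (A : set E) :
  convex_set A <-> forall (x y : E) (s t : R), 0 <= s -> 0 <= t -> s + t = 1 ->
    A x -> A y -> A (s *: x + t *: y).
Proof.
split=> [cA x y s t s0 t0 st Ax Ay | cA x y l /set_mem Ax /set_mem Ay].
  have s1 : s <= 1 by rewrite -st lerDl.
  have -> : t = 1 - s by rewrite -st addrAC subrr add0r.
  exact: set_mem (cA x y (Itv01 s0 s1) (mem_set Ax) (mem_set Ay)).
apply: mem_set; apply: cA => //.
  by rewrite subr_ge0.
by rewrite addrC subrK.
Qed.

(** The open ball of radius e and center 0 for the gauge of A, which is
    possibly infinite.  Asking for a radius r strictly below e, rather than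
    for e itself, is what makes these balls open ([gauge_ball_open]). *)
Definition gauge_ball (R : realType) (E : lmodType R) (A : set E) (e : R) :
    set E :=
  [set v | exists2 r, 0 < r < e & A (r^-1 *: v)].

Section gauge_ball_theory.
Context (R : realType) (E : lmodType R) (A : set E).
Hypotheses (cA : absolutely_convex A) (A0 : A 0).

Lemma abs_convex_scale (r s : R) (v : E) :
  0 < r -> r <= s -> A (r^-1 *: v) -> A (s^-1 *: v).
Proof.
move=> r0 rs Av; have s0 : 0 < s by apply: lt_le_trans rs.
have -> : s^-1 *: v = (r / s) *: (r^-1 *: v).
  by rewrite scalerA mulrAC mulfV ?gt_eqF// mul1r.
apply: cA.2 => //.
by rewrite normrM normfV !gtr0_norm// ler_pdivrMr ?mul1r.
Qed.

Lemma gauge_ball0 (e : R) : 0 < e -> gauge_ball A e 0.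
Proof.
move=> e0; exists (e / 2); last by rewrite scaler0.
by apply/andP; split; lra.
Qed.

Lemma gauge_ballS (e e' : R) : e <= e' -> gauge_ball A e `<=` gauge_ball A e'.
Proof.
move=> ee' v [r /andP[r0 re] Av]; exists r => //.
by rewrite r0 (lt_le_trans re).
Qed.

Lemma gauge_ballD (a b : R) (v w : E) :
  gauge_ball A a v -> gauge_ball A b w -> gauge_ball A (a + b) (v + w).
Proof.
move=> [r /andP[r0 ra] Av] [s /andP[s0 sb] Aw]; exists (r + s).
  by rewrite addr_gt0// ltrD.
have rs0 : 0 < r + s by rewrite addr_gt0.
have -> : (r + s)^-1 *: (v + w) =
    (r / (r + s)) *: (r^-1 *: v) + (s / (r + s)) *: (s^-1 *: w).
  by rewrite !scalerA scalerDr; congr (_ *: _ + _ *: _); field; rewrite !gt_eqF.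
move/convex_setP : cA.1; apply => //.
- by rewrite divr_ge0 ?ltW.
- by rewrite divr_ge0 ?ltW.
- by rewrite -mulrDl divff ?gt_eqF.
Qed.

Lemma gauge_ballZ (c t e : R) (v : E) : 0 < c -> `|t| <= c ->
  gauge_ball A e v -> gauge_ball A (c * e) (t *: v).
Proof.
move=> c0 tc [r /andP[r0 re] Av]; exists (c * r).
  by rewrite mulr_gt0// ltr_pM2l.
have -> : (c * r)^-1 *: (t *: v) = (t / c) *: (r^-1 *: v).
  by rewrite !scalerA; congr (_ *: _); field; rewrite !gt_eqF.
apply: cA.2 => //.
by rewrite normrM normfV (gtr0_norm c0) ler_pdivrMr ?mul1r.
Qed.

Lemma convex_gauge_ball (e : R) : convex_set (gauge_ball A e).
Proof.
apply/convex_setP => v w s t s0 t0 st [r /andP[r0 re] Av] [q /andP[q0 qe] Aw].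
exists (Num.max r q).
  by rewrite lt_max r0 gt_max re qe.
rewrite scalerDr !scalerA ![_^-1 * _]mulrC -!scalerA.
move/convex_setP : cA.1; apply => //.
  by apply: (@abs_convex_scale r) => //; rewrite le_max lexx.
by apply: (@abs_convex_scale q) => //; rewrite le_max lexx orbT.
Qed.

Lemma gauge_ball_open (e : R) (v : E) : gauge_ball A e v ->
  exists2 d, 0 < d & forall w, gauge_ball A d (w - v) -> gauge_ball A e w.
Proof.
move=> [r /andP[r0 re] Av]; pose d := (e - r) / 2.
have d0 : 0 < d by rewrite divr_gt0// subr_gt0.
exists d => // w dw; have -> : w = v + (w - v) by rewrite addrC subrK.
apply: (@gauge_ballS ((r + d) + d)); first by rewrite /d; lra.
apply: gauge_ballD => //; exists r => //.
by rewrite r0 ltrDl.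
Qed.

(** The vectors of finite gauge, that is, the linear span of A. *)
Definition gauge_span : {pred E} :=
  fun v => `[< exists2 r : R, 0 < r & A (r^-1 *: v) >].

Lemma gauge_spanP v :
  reflect (exists e, gauge_ball A e v) (v \in gauge_span).
Proof.
apply: (iffP (asboolP _)) => [[r r0 Av] | [e [r /andP[r0 _] Av]]];
  last by exists r.
by exists (r + 1); exists r => //; rewrite r0 ltrDl ltr01.
Qed.

Lemma gauge_span_submod_closed : subsemimod_closed gauge_span.
Proof.
split; first split.
- by apply/gauge_spanP; exists 1; exact: gauge_ball0.
- move=> v w /gauge_spanP[a av] /gauge_spanP[b bw]; apply/gauge_spanP.
  by exists (a + b); exact: gauge_ballD.
- move=> t v /gauge_spanP[e ev]; apply/gauge_spanP; exists ((`|t| + 1) * e).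
  by apply: gauge_ballZ => //; rewrite ?lerDl// ltr_wpDl.
Qed.

End gauge_ball_theory.

Lemma near0_shift (R : realType) (L : tvsType R) (x : L) (P : set L) :
  nbhs x P <-> \forall v \near (0 : L), P (x + v).
Proof.
split=> [xP | P0].
  have := @nbhsB _ _ _ x (- x) xP; rewrite addNr; apply: filterS => _ [w Pw <-].
  by rewrite addrA addrN add0r.
by apply: filterS (nbhsT x P0) => _ [w Pw <-].
Qed.

Lemma near0_split (R : realType) (L : tvsType R) (U : set L) :
  nbhs (0 : L) U ->
  exists2 V : set L, nbhs (0 : L) V & forall v w, V v -> V w -> U (v + w).
Proof.
move=> U0; have /= := @add_continuous L (0, 0) U.
rewrite addr0 => /(_ U0)[[V W] /= [V0 W0] VW].
exists (V `&` W); first exact: filterI.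
by move=> v w [Vv _] [_ Ww]; exact: (VW (v, w)).
Qed.

(** * The span of a set, with its gauge added to the topology *)

Section gauge_space.
Context (R : realType) (L : tvsType R) (A : set L).
Hypotheses (cA : absolutely_convex A) (A0 : A 0).

HB.instance Definition _ := GRing.isSubmodClosed.Build R L (gauge_span A)
  (gauge_span_submod_closed cA A0).

(** The span of A is wrapped in a new type so that it can carry a topology
    different from the one induced by L. *)
Record gauge_space := GaugeSpace {
  gauge_val : L;
  gauge_valP : gauge_val \in gauge_span A }.

HB.instance Definition _ := [isSub for gauge_val].
HB.instance Definition _ := [Choice of gauge_space by <:].
HB.instance Definition _ := [SubChoice_isSubLmodule of gauge_space by <:].

(** The supremum of the topology induced by L and that of the gauge. Keeping
    the former makes the space Hausdorff even if the gauge vanishes on nonzero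
    vectors, and makes the inclusion into L continuous. *)
Definition gauge_nbhs (x : gauge_space) (P : set gauge_space) : Prop :=
  exists2 U, nbhs (0 : L) U & exists2 e, 0 < e & forall y,
    U (val y - val x) -> gauge_ball A e (val y - val x) -> P y.

HB.instance Definition _ := hasNbhs.Build gauge_space gauge_nbhs.

Let nbhs_filter (x : gauge_space) : ProperFilter (nbhs x).
Proof.
split.
  move=> [U U0 [e e0 /(_ x)]]; rewrite subrr; apply.
    exact: nbhs_singleton.
  exact: gauge_ball0.
split.
- by exists setT; [exact: filterT | exists 1].
- move=> P Q [U U0 [e e0 UP]] [V V0 [d d0 VQ]].
  exists (U `&` V); first exact: filterI.
  exists (Num.min e d); first by rewrite lt_min e0.
  move=> y [Uy Vy] edy; split.
    apply: UP => //; apply: (gauge_ballS _ edy).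
    by rewrite ge_min lexx.
  apply: VQ => //; apply: (gauge_ballS _ edy).
  by rewrite ge_min lexx orbT.
- move=> P Q PQ [U U0 [e e0 UP]]; exists U => //; exists e => // y Uy ey.
  exact/PQ/UP.
Qed.

Let nbhs_singleton (x : gauge_space) (P : set gauge_space) : nbhs x P -> P x.
Proof.
move=> [U U0 [e e0 /(_ x)]]; rewrite subrr; apply.
  exact: nbhs_singleton.
exact: gauge_ball0.
Qed.

Let nbhs_nbhs (x : gauge_space) (P : set gauge_space) :
  nbhs x P -> nbhs x (nbhs^~ P).
Proof.
move=> [U U0 [e e0 UP]]; have [V V0 VU] := near0_split U0.
exists V => //; exists (e / 2); first by rewrite divr_gt0.
move=> y Vy ey; exists V => //; exists (e / 2); first by rewrite divr_gt0.
move=> z Vz ez; have zE : val z - val x = (val z - val y) + (val y - val x).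
  by rewrite addrA subrK.
apply: UP; rewrite zE; first exact: VU.
by rewrite [e]splitr; apply: gauge_ballD.
Qed.

HB.instance Definition _ := Nbhs_isNbhsTopological.Build gauge_space
  nbhs_filter nbhs_singleton nbhs_nbhs.

Let add_continuous :
  continuous (fun x : gauge_space * gauge_space => x.1 + x.2).
Proof.
move=> [x y] P [U U0 [e e0 UP]]; have [V V0 VU] := near0_split U0.
pose N (z : gauge_space) := [set z' : gauge_space |
  V (val z' - val z) /\ gauge_ball A (e / 2) (val z' - val z)].
have NN z : nbhs z (N z).
  by exists V => //; exists (e / 2); [rewrite divr_gt0 | move=> z' ? ?; split].
exists (N x, N y) => //= -[x' y'] /= [[Vx ex] [Vy ey]].
apply: UP; rewrite /= !raddfD/= addrACA; first exact: VU.
by rewrite [e]splitr; apply: gauge_ballD.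
Qed.

Let scale_continuous :
  continuous (fun z : R^o * gauge_space => z.1 *: z.2).
Proof.
move=> [k x] P [U U0 [e e0 UP]].
have /gauge_spanP[r rx] := gauge_valP x.
have [s /andP[s0 _] sx] := rx.
have {}rx : gauge_ball A (s + 1) (val x).
  by exists s => //; rewrite s0 ltrDl ltr01.
(* t y - k x = t (y - x) + (t - k) x, where |t| <= |k| + 1 once t is within 1
   of k, and where x has gauge at most s + 1: each term gets half of e. *)
pose c := `|k| + 1; have c0 : 0 < c by rewrite ltr_wpDl.
have [[T W] /= [Tk Wx] TW] : nbhs ((k : R^o), val x)
    [set z : R^o * L | U (z.1 *: z.2 - k *: val x)].
  apply: (@scale_continuous R L (k, val x) [set w | U (w - k *: val x)]).
  by apply/near0_shift; apply: filterS U0 => v; rewrite /= addrAC subrr add0r.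
pose d := Num.min 1 (e / 2 / (s + 1)).
have d0 : 0 < d by rewrite lt_min ltr01 /= !divr_gt0// addr_gt0.
exists (T `&` [set t | `|k - t| < d],
    [set y : gauge_space | W (val y) /\
      gauge_ball A (e / 2 / c) (val y - val x)]).
  split => /=.
    by apply: filterI => //; apply/nbhs_ballP; exists d.
  exists [set v | W (val x + v)]; first exact: (near0_shift (val x) W).1.
  exists (e / 2 / c); first by rewrite !divr_gt0.
  by move=> y; rewrite /= addrC subrK.
move=> [t y] /= [[Tt kt] [Wy ey]]; apply: UP.
  by rewrite /= !linearZ/= scalerN; exact: (TW (t, val y)).
rewrite /=; have -> : gauge_val (t *: y) - gauge_val (k *: x) =
    t *: (val y - val x) + (t - k) *: val x.
  by rewrite !linearZ/= scalerBr scalerN scalerBl addrA subrK.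
have <- : c * (e / 2 / c) + e / 2 / (s + 1) * (s + 1) = e.
  by field; rewrite !gt_eqF// addr_gt0.
apply: gauge_ballD => //; apply: gauge_ballZ => //.
  rewrite /c -(subrK k t) addrC; apply: le_trans (ler_normD _ _) _.
  by rewrite lerD2l distrC (le_trans (ltW kt))// ge_min lexx.
  by rewrite !divr_gt0// addr_gt0.
by rewrite distrC (le_trans (ltW kt))// ge_min lexx orbT.
Qed.

Let locally_convex : exists2 B : set_system gauge_space,
  (forall b, b \in B -> convex_set b) & basis B.
Proof.
exists [set b | open b /\ convex_set b].
  by move=> b /set_mem[].
split=> [b [] // | x P [U U0 [e e0 UP]]].
have [B Bconv [Bopen /(_ 0 U U0)[b [Bb b0] bU]]] := @locally_convex R L.
exists [set y | b (val y - val x) /\ gauge_ball A e (val y - val x)];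
  last first.
  by move=> y [by_ ey]; apply: UP => //; exact: bU.
split; last by rewrite /= subrr; split=> //; exact: gauge_ball0.
split.
  rewrite openE => y [yb ye].
  have [d d0 de] := gauge_ball_open cA ye.
  exists [set v | b (val y - val x + v)].
    apply: (near0_shift _ b).1; apply: open_nbhs_nbhs; split=> //.
    exact: Bopen.
  exists d => // z bz dz; split.
    by move: bz; rewrite /= addrC addrA subrK.
  by apply: de; rewrite opprB addrA subrK.
apply/convex_setP => y z s t s0 t0 st [yb ye] [zb ze].
have E : val (s *: y + t *: z) - val x =
    s *: (val y - val x) + t *: (val z - val x).
  by rewrite raddfD/= !scalerBr addrACA -opprD -scalerDl st scale1r.
rewrite /= E; split.
  by move/convex_setP : (Bconv _ (mem_set Bb)); apply.
by move/convex_setP : (@convex_gauge_ball _ _ _ cA e); apply.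
Qed.

HB.instance Definition _ := PreTopologicalLmod_isTvs.Build R gauge_space
  add_continuous scale_continuous locally_convex.
HB.instance Definition _ :=
  PreTopologicalNmodule_isTopologicalNmodule.Build gauge_space add_continuous.
HB.instance Definition _ :=
  TopologicalNmodule_isTopologicalLmodule.Build R gauge_space scale_continuous.
HB.instance Definition _ := Uniform_isTvs.Build R gauge_space locally_convex.

Lemma gauge_val_continuous : continuous (val : gauge_space -> L).
Proof.
move=> x P /near0_shift P0; exists [set v | P (val x + v)] => //.
by exists 1 => // y; rewrite /= addrC subrK.
Qed.

Lemma gauge_space_hausdorff : hausdorff_space L -> hausdorff_space gauge_space.
Proof.
move=> hL x y xy; apply: val_inj; apply: hL => P Q Px Qy.
have [z [Pz Qz]] := xy _ _ (gauge_val_continuous Px) (gauge_val_continuous Qy).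
by exists (val z).
Qed.


(** The converse of the obvious fact that the gauge of an absolutely convex
    neighborhood of 0 is finite and continuous along i: the topology of a free
    space is fine enough for these two conditions to suffice. *)
Lemma free_lcs_nbhs0 (X : topologicalType) (i : X -> L) :
  free_lcs i ->
  (forall x, exists e, gauge_ball A e (i x)) ->
  (forall x e, 0 < e -> \forall y \near x, gauge_ball A e (i y - i x)) ->
  nbhs (0 : L) A.
Proof.
move=> [hL ci univ] absA contA.
have iA x : i x \in gauge_span A by apply/gauge_spanP.
pose f (x : X) : gauge_space := GaugeSpace (iA x).
have cf : continuous f.
  move=> x P [U U0 [e e0 UP]].
  have Ux : \forall y \near x, U (i y - i x).
    apply: (ci x [set v | U (v - i x)]); apply/near0_shift.
    by apply: filterS U0 => v; rewrite /= addrAC subrr add0r.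
  by apply: filterS2 Ux (contA x e e0) => y Uy ey; exact: UP.
have [g [[g_lin g_cont fE] _]] :=
  univ gauge_space f (gauge_space_hausdorff hL) cf.
have [h [_ h_uniq]] := univ L i hL ci.
(* Both the identity and g followed by the inclusion extend i to L. *)
have gE : h = val \o g.
  apply: h_uniq; split.
  - by move=> t u w; rewrite -[LHS]/(val (g (t *: u + w))) g_lin linearP.
  - move=> u; apply: continuous_comp; first exact: g_cont.
    exact: gauge_val_continuous.
  - by apply/funext => x; rewrite /= -[g (i x)]/((g \o i) x) -fE.
have hE : h = id by apply: h_uniq; split=> // u.
have gK v : val (g v) = v by rewrite -[LHS]/((val \o g) v) -gE hE.
have g0 : g 0 = 0 by apply: val_inj; rewrite gK raddf0.
have : nbhs (0 : L) (g @^-1` [set s | gauge_ball A 1 (val s)]).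
  apply: g_cont; rewrite g0; exists setT; first exact: filterT.
  by exists 1 => // s _ /=; rewrite subr0.
apply: filterS => v /=; rewrite -[gauge_val _]/(val (g v)) gK.
move=> [r /andP[r0 r1] /(abs_convex_scale cA r0 (ltW r1))].
by rewrite invr1 scale1r.
Qed.

End gauge_space.

(** * Absorption and boundedness *)

Lemma balanced_absorbs (R : realType) (E : lmodType R) (A B : set E) (r : R) :
  balanced A -> 0 < r -> (forall v, B v -> A (r^-1 *: v)) -> absorbs A B.
Proof.
move=> bA r0 BA; exists r => // t rt v Bv.
have t0 : t != 0 by rewrite -normr_gt0 (lt_le_trans r0).
exists (t^-1 *: v); last by rewrite scalerA mulfV ?scale1r.
have -> : t^-1 *: v = (r / t) *: (r^-1 *: v).
  by rewrite scalerA; congr (_ *: _); field; rewrite t0 gt_eqF.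
apply: bA; last exact: BA.
by rewrite normrM normfV gtr0_norm// ler_pdivrMr ?normr_gt0// mul1r.
Qed.

Lemma absorbs_scale (R : realType) (E : lmodType R) (A B : set E) :
  absorbs A B -> exists2 r : R, 0 < r & forall v, B v -> A (r^-1 *: v).
Proof.
move=> [r r0 rB]; exists r => // v Bv.
have /(rB r)/(_ v Bv)[w Aw <-] : r <= `|r| by exact: ler_norm.
by rewrite scalerA mulVf ?gt_eqF// scale1r.
Qed.

Lemma tvs_bounded_set1 (R : realType) (E : tvsType R) (x : E) :
  tvs_bounded [set x].
Proof.
move=> U U0; have := @scale_continuous R E (0, x) U.
rewrite /= scale0r => /(_ U0)[[T W] /= [T0 Wx] TW].
have /nbhs_ballP[d /= d0 dT] := T0.
exists (2 / d); first by rewrite divr_gt0.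
move=> t dt _ ->.
have t0 : 0 < `|t| by rewrite (lt_le_trans _ dt)// divr_gt0.
exists (t^-1 *: x); last by rewrite scalerA mulfV ?scale1r// -normr_gt0.
apply: (TW (t^-1, x)); split => /=; last exact: nbhs_singleton.
apply: dT; rewrite -ball_normE /= sub0r normrN normfV.
rewrite invf_plt ?posrE// (lt_le_trans _ dt)//.
by rewrite -[ltLHS]mul1r ltr_pM2r ?invr_gt0// ltr1n.
Qed.

(** * Sets defined by bounds on linear functionals *)

Section slab.
Context (R : realType) (E : tvsType R) (I : Type) (D : set I).
Variables (g : I -> E -> R^o) (c : I -> R).
Hypotheses (g_lin : forall k, D k -> linear (g k))
  (c0 : forall k, D k -> 0 <= c k).

(** The polar of the functionals g k / c k if all c k are positive.  Both the
    barrel that detects discreteness and the neighborhood that controls bounded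
    sets are of this form. *)
Definition slab : set E := [set v | forall k, D k -> `|g k v| <= c k].

Let gZ k t v : D k -> g k (t *: v) = t * g k v.
Proof. by move=> Dk; rewrite (GRing.scalable_linear (g_lin Dk)). Qed.

Lemma slab_abs_convex : absolutely_convex slab.
Proof.
split.
  apply/convex_setP => v w s t s0 t0 st vS wS k Dk.
  rewrite g_lin// gZ// -[c k]mul1r -st mulrDl.
  apply: le_trans (ler_normD _ _) _.
  rewrite !normrM (ger0_norm s0) (ger0_norm t0).
  by apply: lerD; rewrite ler_wpM2l//; [exact: vS | exact: wS].
move=> t v t1 vS k Dk; rewrite gZ// normrM.
by apply: le_trans (vS k Dk); rewrite ler_piMl.
Qed.

Lemma slab0 : slab 0.
Proof. by move=> k Dk; rewrite -(scale0r 0) gZ// mul0r normr0 c0. Qed.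

Lemma slab_scale (r : R) (v : E) : 0 < r ->
  slab (r^-1 *: v) <-> forall k, D k -> `|g k v| <= r * c k.
Proof.
move=> r0.
have gS k : D k -> (`|g k (r^-1 *: v)| <= c k) = (`|g k v| <= r * c k).
  move=> Dk; rewrite gZ// normrM normfV (gtr0_norm r0).
  by rewrite ler_pdivrMl.
by split=> vS k Dk; have := vS k Dk; rewrite gS.
Qed.

Lemma slab_closed : (forall k, D k -> continuous (g k)) -> closed slab.
Proof.
move=> g_cont.
have -> : slab = \bigcap_(k in D) (fun v => `|g k v|) @^-1` [set t | t <= c k].
  by apply/seteqP; split.
apply: closed_bigI => k Dk; apply: preimage_closed; last exact: closed_le.
move=> v _; apply: continuous_comp; first exact: g_cont.
exact: norm_continuous.
Qed.

End slab.

(** * Bounded sets and barrels in free locally convex spaces *)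

(** The dual of a free space L identifies with the space of continuous functions
    on X; this is the unit ball of the supremum norm on the bounded ones. *)
Definition sup_dual_ball (R : realType) (X : Type) (L : tvsType R)
    (i : X -> L) : set (L -> R^o) :=
  [set g | [/\ linear g, continuous g & forall x, `|g (i x)| <= 1]].

Section free_lcs_theory.
Context (R : realType) (X : topologicalType) (L : tvsType R) (i : X -> L).
Hypothesis freeL : free_lcs i.

(** The bounds 2 ^ n tend to infinity while every g n is at most 2 on
    i y - i x, so the gauge of the slab is governed near x by finitely many of
    the g n, which are continuous. *)
Lemma sup_dual_ball_geometric_slab (g : nat -> L -> R^o) :
  (forall n, sup_dual_ball i (g n)) ->
  nbhs (0 : L) (slab setT g (fun n => 2 ^+ n)).
Proof.
move=> gP; have g_lin n : [set: nat] n -> linear (g n) by have [] := gP n.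
have c0 n : [set: nat] n -> 0 <= 2 ^+ n :> R by rewrite exprn_ge0.
have pow1 n : 1 <= 2 ^+ n :> R by rewrite exprn_ege1 ?ler1n.
have [_ ci _] := freeL.
apply: (free_lcs_nbhs0 (slab_abs_convex _ g_lin) (slab0 g_lin c0) freeL).
  move=> x; exists 2; exists 1; first by rewrite ltr01 ltr1n.
  rewrite invr1 scale1r => n _; have [_ _ gi] := gP n.
  exact: le_trans (gi x) (pow1 n).
move=> x e e0; pose r := e / 2; have r0 : 0 < r by rewrite divr_gt0.
have gB n y : g n (i y - i x) = g n (i y) - g n (i x).
  by rewrite (GRing.zmod_morphism_linear (g_lin n I)).
pose N := (Num.truncn (2 / r)).+1.
have large n : (N <= n)%N -> 2 <= r * 2 ^+ n.
  move=> Nn; rewrite mulrC -ler_pdivrMr//.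
  apply: le_trans (ltW (truncnS_gt _)) _.
  rewrite -/N (@le_trans _ _ n%:R) ?ler_nat//.
  by rewrite -natrX ler_nat ltnW// ltn_expl.
have small : \forall y \near x, forall n : 'I_N, `|g n (i y) - g n (i x)| <= r.
  apply: filter_forall => n; have [_ gc _] := gP n.
  have : {for x, continuous (g n \o i)}.
    by apply: continuous_comp; [exact: ci | exact: gc].
  move=> /cvgrPdist_le/(_ r r0); apply: filterS => y /=.
  by rewrite distrC.
apply: filterS small => y small; exists r.
  by rewrite r0 /r; lra.
apply/slab_scale => // n _; rewrite gB.
have [nN|Nn] := ltnP n N.
  by apply: le_trans (small (Ordinal nN)) _; rewrite ler_peMr// ltW.
have [_ _ gi] := gP n.
apply: le_trans (large n Nn); apply: le_trans (ler_normB _ _) _.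
by have := gi x; have := gi y; lra.
Qed.

(** A uniform boundedness principle: a bounded subset of L is bounded in total
    variation.  If it were not, points v_n of B with |g_n v_n| > 4 ^ n would
    escape every multiple of the slab with bounds 2 ^ n. *)
Lemma sup_dual_ball_unif_bounded (B : set L) : tvs_bounded B ->
  exists2 c : R, 0 < c &
    forall g v, sup_dual_ball i g -> B v -> `|g v| <= c.
Proof.
move=> Bbd; apply: contrapT => unbd.
have /choice[gv gvP] : forall n : nat, exists gv : (L -> R^o) * L,
    [/\ sup_dual_ball i gv.1, B gv.2 & 4 ^+ n < `|gv.1 gv.2|].
  move=> n; apply: contrapT => small; apply: unbd.
  exists (4 ^+ n); first by rewrite exprn_gt0.
  move=> g v gD Bv; rewrite leNgt; apply/negP => gv_gt.
  by apply: small; exists (g, v).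
have gD n : sup_dual_ball i (gv n).1 by have [] := gvP n.
have g_lin n : [set: nat] n -> linear (gv n).1 by have [] := gD n.
have [r r0 rB] := absorbs_scale (Bbd _ (sup_dual_ball_geometric_slab gD)).
have bound n : 2 ^+ n < r.
  have [_ Bv lt4] := gvP n.
  have /(slab_scale _ g_lin _ r0)/(_ n I) le2 := rB _ Bv.
  have : 2 ^+ n * 2 ^+ n < r * 2 ^+ n.
    by rewrite -exprMn -natrM; exact: lt_le_trans lt4 le2.
  by rewrite ltr_pM2r// exprn_gt0.
have := bound (Num.truncn r).+1; apply/negP; rewrite -leNgt.
apply: le_trans (ltW (truncnS_gt _)) _.
by rewrite -natrX ler_nat ltnW// ltn_expl.
Qed.

(** On a discrete space y near x means y = x, so every barrel passes the
    criterion of [free_lcs_nbhs0], barrels being absorbing. *)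
Lemma discrete_free_lcs_barrelled : discrete_space X -> barrelled L.
Proof.
move=> dX A [_ cA absA].
have A0 : A 0.
  have [r r0 /(_ 0 erefl) Ar] := absorbs_scale (absA 0).
  by rewrite scaler0 in Ar.
apply: (free_lcs_nbhs0 cA A0 freeL).
  move=> x; have [r r0 /(_ _ erefl) Ar] := absorbs_scale (absA (i x)).
  by exists (r + 1), r => //; rewrite r0 ltrDl ltr01.
move=> x e e0; have : nbhs x [set x] by apply: open_nbhs_nbhs; split.
by apply: filterS => _ ->; rewrite subrr; exact: gauge_ball0.
Qed.

Lemma free_lcs_lift (f : X -> R) : continuous f ->
  exists g : L -> R^o, [/\ linear g, continuous g & forall x, g (i x) = f x].
Proof.
move=> cf; have [_ _ univ] := freeL.
have [g [[g_lin g_cont fE] _]] := univ R^o f (@Rhausdorff R) cf.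
by exists g; split=> // x; rewrite fE.
Qed.

(** The polar of the functionals bounded by 1 on X is a bornivorous barrel, and
    complete regularity keeps i y - i x away from 0 for its gauge whenever y
    differs from x. *)
Lemma quasibarrelled_free_lcs_discrete :
  tychonoff_space X -> quasibarrelled L -> discrete_space X.
Proof.
move=> [hX crX] qL.
pose A := slab (sup_dual_ball i) id (fun=> 1).
have D_lin (g : L -> R^o) : sup_dual_ball i g -> linear (id g) by case.
have A_born : bornivorous A.
  move=> B /sup_dual_ball_unif_bounded[c c0 cB].
  apply: (balanced_absorbs (slab_abs_convex _ D_lin).2 c0) => v Bv.
  by apply/slab_scale => // g Dg; rewrite mulr1; exact: cB.
have A_barrel : barrel A.
  split; first by apply: slab_closed => g [].
    exact: slab_abs_convex.
  by move=> x; apply: A_born; exact: tvs_bounded_set1.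
have A_nbhs := qL A A_barrel A_born.
have [_ ci _] := freeL.
have isolated (x : X) : nbhs x [set x].
  have half0 : (2^-1 : R) != 0 by rewrite invr_neq0.
  have : nbhs x (i @^-1` [set v | A (2 *: (v - i x))]).
    apply: ci; apply/near0_shift; have := nbhs0Z half0 A_nbhs.
    apply: filterS => _ [w Aw <-] /=.
    by rewrite addrAC subrr add0r scalerA mulfV// scale1r.
  apply: filterS => y /= Ay; apply: contrapT => yx.
  have /(@uniform_separatorP _ R)[f [cf f01 fx fy]] :
      uniform_separator [set x] [set y].
    apply: crX; last by move=> xy; exact: yx.
    exact/accessible_closed_set1/hausdorff_accessible.
  have [g [g_lin g_cont gi]] := free_lcs_lift cf.
  have gD : sup_dual_ball i g.
    split=> // z; rewrite gi.
    have /f01 : range f (f z) by exists z.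
    by rewrite /= in_itv /= => /andP[fz0 fz1]; rewrite ger0_norm.
  have fx0 : f x = 0 by apply: fx; exists x.
  have fy1 : f y = 1 by apply: fy; exists y.
  have gE : g (2 *: (i y - i x)) = 2.
    rewrite (GRing.scalable_linear g_lin) (GRing.zmod_morphism_linear g_lin).
    by rewrite !gi fx0 fy1 subr0; exact: mulr1.
  by have := Ay g gD; rewrite /id gE ger0_norm// leNgt ltr1n.
move=> U; rewrite openE => x Ux.
by apply: filterS (isolated x) => _ ->.
Qed.

End free_lcs_theory.

Lemma barrelled_quasibarrelled (R : realType) (E : tvsType R) :
  barrelled E -> quasibarrelled E.
Proof. by move=> bE A /bE. Qed.

Theorem theorem5p4 (R : realType) (X : topologicalType) (L : tvsType R)
    (i : X -> L) (tychX : tychonoff_space X) (freeL : free_lcs i) :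
  [<-> discrete_space X; barrelled L; quasibarrelled L].
Proof.
tfae.
- exact: discrete_free_lcs_barrelled freeL.
- exact: barrelled_quasibarrelled.
- exact: quasibarrelled_free_lcs_discrete freeL tychX.
Qed.
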